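(* Let $m_x,m_y\ge 1$ be integers, $n_x=m_x+1$, $n_y=m_y+1$, and let $\mathcal X_k=\{(x_r^k,y_s^k): 1\le r\le n_x,\ 1\le s\le n_y\}$ be a local Cartesian subgrid of size $n_x\times n_y$ with $x_1^k<\dots<x_{n_x}^k$, $y_1^k<\dots<y_{n_y}^k$, and geometric support $\Omega_k=[x_1^k,x_{n_x}^k]\times[y_1^k,y_{n_y}^k]$. Let $u\in C^{m_x+1,m_y+1}(\Omega_k)$, and let $\mathcal I_k[u]$ be the tensor-product Lagrange interpolant of $u$ on $\mathcal X_k$. Put $$h_{x,k}=\max_{1\le r\le n_x-1}|x_r^k-x_{r+1}^k|,\qquad h_{y,k}=\max_{1\le s\le n_y-1}|y_s^k-y_{s+1}^k|,\qquad h=\max\{h_{x,k},h_{y,k}\}.$$ Then there exists a constant $C_k>0$, depending on $u$ and the degrees $m_x,m_y$, such that $$\|u-\mathcal I_k[u]\|_{\Omega_k}\le C_k\left(h^{m_x+1}+h^{m_y+1}+h^{m_x+m_y+2}\right),$$ where $\|\cdot\|_{\Omega_k}$ is the supremum norm on $\Omega_k$. In particular, if $m=m_x=m_y$ and $h<1$, then, for a constant $\mathcal C_k$, $$\|u-\mathcal I_k[u]\|_{\Omega_k}\le \mathcal C_k\,h^{m+1}.$$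
   Context: $C^{p,q}(\Omega_k)$ denotes the space of functions $u:\Omega_k\to\mathbb R$ whose partial derivatives $\partial_x^\alpha\partial_y^\beta u$ exist and are continuous on $\Omega_k$ for all integers $0\le\alpha\le p$ and $0\le\beta\le q$. Local interpolant: for $\mathbf x=(x,y)\in\mathbb R^2$, $$\mathcal I_k[u](\mathbf x)=\sum_{r=1}^{n_x}\sum_{s=1}^{n_y}u(x_r^k,y_s^k)\,\ell_{x,r}^k(x)\,\ell_{y,s}^k(y),$$ where $\ell_{x,r}^k$ and $\ell_{y,s}^k$ are the one-dimensional Lagrange basis polynomials associated with the nodes $\{x_r^k\}_{r=1}^{n_x}$ and $\{y_s^k\}_{s=1}^{n_y}$, respectively. *)

(* Defs.v *)
From HB Require Import structures.
From mathcomp Require Import all_boot all_order all_algebra.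
From mathcomp Require Import all_classical all_reals all_analysis.

Set Implicit Arguments.
Unset Strict Implicit.
Unset Printing Implicit Defensive.

Import Order.TTheory GRing.Theory Num.Theory.
Import numFieldNormedType.Exports.

Local Open Scope classical_set_scope.
Local Open Scope ring_scope.

(* Derivatives are taken relative to a set [A], so that on a closed interval
   they are one-sided at the endpoints. *)
Definition derivable_in (R : realType) (A : set R) (f : R -> R) (x : R) : Prop :=
  cvg ((f t - f x) / (t - x) @[t --> within A x^']).

Definition derive_in (R : realType) (A : set R) (f : R -> R) (x : R) : R :=
  lim ((f t - f x) / (t - x) @[t --> within A x^']).

Definition derivable_x (R : realType) (Omega : set (R * R)) (u : R * R -> R)
    (z : R * R) : Prop :=
  derivable_in (ysection Omega z.2) (fun t => u (t, z.2)) z.1.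

Definition derivable_y (R : realType) (Omega : set (R * R)) (u : R * R -> R)
    (z : R * R) : Prop :=
  derivable_in (xsection Omega z.1) (fun t => u (z.1, t)) z.2.

Definition partial_x (R : realType) (Omega : set (R * R)) (u : R * R -> R) :
    R * R -> R :=
  fun z => derive_in (ysection Omega z.2) (fun t => u (t, z.2)) z.1.

Definition partial_y (R : realType) (Omega : set (R * R)) (u : R * R -> R) :
    R * R -> R :=
  fun z => derive_in (xsection Omega z.1) (fun t => u (z.1, t)) z.2.

Definition partial_xy (R : realType) (Omega : set (R * R)) (alpha beta : nat)
    (u : R * R -> R) : R * R -> R :=
  iter alpha (partial_x Omega) (iter beta (partial_y Omega) u).

(* [derive_in] is total, hence the first two clauses: each differentiation
   step needed to form [partial_xy Omega alpha beta u] is legitimate. *)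
Definition Cpq (R : realType) (p q : nat) (Omega : set (R * R))
    (u : R * R -> R) : Prop :=
  [/\ forall beta z, (beta < q)%N -> Omega z ->
        derivable_y Omega (partial_xy Omega 0 beta u) z,
      forall alpha beta z, (alpha < p)%N -> (beta <= q)%N -> Omega z ->
        derivable_x Omega (partial_xy Omega alpha beta u) z
    & forall alpha beta, (alpha <= p)%N -> (beta <= q)%N ->
        {within Omega, continuous (partial_xy Omega alpha beta u)}].

(* Nodes are numbered from 0, so the [m.+1] nodes are [x 0, ..., x m]; the
   values of the sequence [x] beyond [m] play no role. *)
Definition is_nodes (R : realType) (m : nat) (a b : R) (x : nat -> R) : Prop :=
  [/\ x 0%N = a, x m = b & forall i, (i < m)%N -> x i < x i.+1].

Definition mesh (R : realType) (m : nat) (x : nat -> R) : R :=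
  \big[Num.max/0]_(r < m) `|x r - x r.+1|.

(* The library lemma [lagrangeE] assumes the whole sequence [x] injective;
   the identification below needs no hypothesis on [x]. *)
Lemma horner_lagrange (R : realType) (n : nat) (x : nat -> R) (r : 'I_n) (t : R) :
  (tnth (n.-lagrange x) r).[t] = \prod_(j < n | j != r) ((t - x j) / (x r - x j)).
Proof.
rewrite [lagrange _ _]unlock tnth_map tnth_ord_tuple npolypK.
  rewrite hornerM hornerC !horner_prod mulrC prodf_div.
  by congr (_ / _); apply: eq_bigr => j _; rewrite hornerXsubC.
rewrite /= mul_polyC (leq_trans (size_scale_leq _ _)) //.
rewrite size_prod => [|j _]; last by rewrite polyXsubC_eq0.
rewrite (eq_bigr (fun=> 2%N)) => [|j _]; last by rewrite size_XsubC.
rewrite sum_nat_const cardC1 card_ord.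
by case: n r => [[]//|n] r /=; rewrite muln2 -addnn -addSn addnK.
Qed.

Definition interpolant (R : realType) (nx ny : nat) (x y : nat -> R)
    (u : R * R -> R) : R * R -> R :=
  fun z => \sum_(r < nx) \sum_(s < ny)
    u (x r, y s) * (tnth (nx.-lagrange x) r).[z.1] * (tnth (ny.-lagrange y) s).[z.2].

(* Extended-real valued: [+oo] for a function unbounded on [Omega]. *)
Definition supnorm (R : realType) (Omega : set (R * R)) (f : R * R -> R) :
    \bar R :=
  ereal_sup [set `|f z|%:E | z in Omega].

(* Main.v *)
(* Write P and Q for Lagrange interpolation in x and in y.  Then
   1 - P Q = (1 - P) + (1 - Q) - (1 - Q) (1 - P), and each one-dimensional
   remainder is controlled by the highest derivative times a power of the
   length of the interval, hence of the mesh size, since b - a <= m h.  This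
   avoids the Lebesgue constants of P and Q, which are not bounded uniformly in
   the nodes.  For the iterated remainder, (1 - P) is applied to the y-derivatives
   of u, so that only the mixed derivative d_x^p d_y^q u is needed, in this
   order. *)

Require Import Defs.
From mathcomp Require Import all_boot all_order all_algebra.
From mathcomp Require Import all_classical all_reals all_analysis.
From mathcomp Require Import ring lra.

Set Implicit Arguments.
Unset Strict Implicit.
Unset Printing Implicit Defensive.

Import Order.TTheory GRing.Theory Num.Theory.
Import numFieldNormedType.Exports.

Local Open Scope classical_set_scope.
Local Open Scope ring_scope.

(** * Relative derivatives and families of successive derivatives *)

(** Near an interior point [A] contains every point, so the difference quotient relative to [A] has
    the ordinary limit. This makes Rolle's theorem applicable to the derivatives in [Cpq]. *)
Lemma derivable_in_interior (R : realType) (A : set R) (f : R -> R) (t : R) :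
  A° t -> derivable_in A f t -> is_derive t 1 f (derive_in A f t).
Proof.
move=> At dft.
have shiftA : h + t @[h --> 0^'] --> within A t^'.
  move=> P /= Pt.
  suff: \forall h \near 0, h != 0 -> P (h + t) by [].
  have cshift : h + t @[h --> (0 : R)] --> t.
    rewrite -[X in _ --> X]add0r; apply: cvgD; [exact: cvg_id | exact: cvg_cst].
  have : \forall z \near t, z != t -> A z -> P z by exact: Pt.
  move=> /cshift Ph; have /cshift Ah : nbhs t A by exact: At.
  near=> h => h0.
  have Phh : h + t != t -> A (h + t) -> P (h + t) by near: h.
  apply: Phh; last by near: h.
  by rewrite -subr_eq0 addrK.
have dq : h^-1 *: ((f \o shift t) (h *: 1) - f t) @[h --> 0^']
    --> derive_in A f t.
  have -> : (fun h : R => h^-1 *: ((f \o shift t) (h *: 1) - f t)) =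
      (fun z => (f z - f t) / (z - t)) \o (fun h => h + t).
    by apply/funext => h /=; rewrite addrK /shift /= scaler1 mulrC.
  exact: cvg_comp shiftA dft.
apply: DeriveDef; first by apply/cvg_ex; exists (derive_in A f t).
exact/cvg_lim.
Unshelve. all: by end_near. Qed.

(** Tailored to repeated use of Rolle's theorem: continuity up to the endpoints, two-sided
    differentiability inside only. The derivatives [F i] are supplied as data, so one-sided
    derivatives at the endpoints cause no trouble. *)
Definition derivative_tower (R : realType) (a b : R) (n : nat)
    (F : nat -> R -> R) : Prop :=
  (forall i, (i <= n)%N -> {within `[a, b], continuous (F i)}) /\
  (forall i t, (i < n)%N -> t \in `]a, b[ -> is_derive t 1 (F i) (F i.+1 t)).

Lemma derivative_towerD (R : realType) (a b : R) n (F G : nat -> R -> R) :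
  derivative_tower a b n F -> derivative_tower a b n G ->
  derivative_tower a b n (fun i => F i + G i).
Proof.
move=> [cF dF] [cG dG]; split=> [i lein t|i t ltin abt].
  by apply: cvgD; [exact: cF | exact: cG].
by apply: is_deriveD; [exact: dF | exact: dG].
Qed.

Lemma derivative_towerZ (R : realType) (a b : R) n k (F : nat -> R -> R) :
  derivative_tower a b n F ->
  derivative_tower a b n (fun i => k *: F i).
Proof.
move=> [cF dF]; split=> [i lein t|i t ltin abt].
  by apply: cvgZr; exact: cF.
by apply: is_deriveZ; exact: dF.
Qed.

Lemma derivative_tower_horner (R : realType) (a b : R) n (p : {poly R}) :
  derivative_tower a b n (fun i => horner p^`(i)).
Proof.
split=> [i _|i t _ _]; last by rewrite derivnS; exact: is_derive_poly.
by apply: continuous_subspaceT => t; exact: continuous_horner.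
Qed.

Lemma derivative_tower_sum (R : realType) (a b : R) n N (k : nat -> R)
    (F : nat -> nat -> R -> R) :
  (forall r, (r < N)%N -> derivative_tower a b n (F r)) ->
  derivative_tower a b n (fun i => \sum_(r < N) k r *: F r i).
Proof.
elim: N => [|N IHN] dF.
  split=> [i _|i t _ _]; rewrite !big_ord0.
    by apply: continuous_subspaceT => t; exact: cvg_cst.
  exact: is_derive_cst.
have -> : (fun i => \sum_(r < N.+1) k r *: F r i) =
    (fun i => \sum_(r < N) k r *: F r i + k N *: F N i).
  by apply/funext => i; rewrite big_ord_recr.
apply: derivative_towerD; last exact/derivative_towerZ/dF.
by apply: IHN => r /ltnW; exact: dF.
Qed.

(** * Rolle's theorem for several zeros *)

(** Rolle's theorem is applied between consecutive zeros. The first zero [x] is kept apart so that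
    the loss of one zero shows in the sizes; [path <%R x s'] keeps the new zeros to the right of
    [x], so that the induction can prepend the zero found in the preceding gap. *)
Lemma Rolle_path (R : realType) (a b : R) (f f' : R -> R) (x : R) (s : seq R) :
  {within `[a, b], continuous f} ->
  (forall t, t \in `]a, b[ -> is_derive t 1 f (f' t)) ->
  {in x :: s, forall z, z \in `[a, b] /\ f z = 0} -> path <%R x s ->
  exists s' : seq R, [/\ size s' = size s, path <%R x s' &
    {in s', forall z, z \in `[a, b] /\ f' z = 0}].
Proof.
move=> cf df; elim: s x => [|y s IHs] x fs /=; first by exists [::].
move=> /andP[xy ys].
have [|s' [ss' ys' fs']] := IHs y _ ys.
  by move=> z zs; apply: fs; rewrite inE zs orbT.
have [xab fx] := fs x (mem_head _ _).
have [yab fy] : y \in `[a, b] /\ f y = 0 by apply: fs; rewrite !inE eqxx orbT.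
have subo z : z \in `]x, y[ -> z \in `]a, b[.
  move: xab yab; rewrite !in_itv /= => /andP[ax _] /andP[_ yb] /andP[xz zy].
  by rewrite (le_lt_trans ax) //= (lt_le_trans zy).
have [||| c cxy dc] := Rolle xy (f := f).
- by move=> z /subo abz; have [] := df z abz.
- apply: continuous_subspaceW cf => z /=.
  move: xab yab; rewrite !in_itv /= => /andP[ax _] /andP[_ yb] /andP[xz zy].
  by rewrite (le_trans ax) //= (le_trans zy).
- by rewrite fx fy.
have fc : f' c = 0.
  by have [_ <-] := df c (subo c cxy); case: dc.
exists (c :: s'); split=> [|/=|z]; first by rewrite /= ss'.
- move: cxy; rewrite in_itv /= => /andP[-> cy] /=.
  by apply: path_le ys' => //; exact: lt_trans.
- rewrite inE => /predU1P[->|/fs'//]; split=> //.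
  by move: (subo c cxy); apply: subset_itv_oo_cc.
Qed.

(** Induction on [n] with the shifted family [F i.+1]: each differentiation costs one zero. *)
Lemma generalized_Rolle (R : realType) (a b : R) n (F : nat -> R -> R)
    (s : seq R) :
  derivative_tower a b n F -> size s = n.+1 -> sorted <%R s ->
  {in s, forall z, z \in `[a, b] /\ F 0%N z = 0} ->
  exists2 c, c \in `[a, b] & F n c = 0.
Proof.
elim: n F s => [|n IHn] F [//|x s] [cF dF] [ss] xs Fs.
  have [xab Fx] := Fs x (mem_head _ _).
  by exists x.
have [s' [ss' xs' Fs']] := Rolle_path (cF 0%N isT)
  (fun t => dF 0%N t isT) Fs xs.
apply: (IHn (fun i => F i.+1) s') => //; [|by rewrite ss'|exact: path_sorted xs'].
by split=> i => [lein|t ltin]; [exact: cF | exact: dF].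
Qed.

(** * The one-dimensional interpolation error *)

(** Here [n] counts the nodes, so the interpolating polynomial has degree less than [n]. *)
Definition lagrange_remainder (R : realType) (n : nat) (x : nat -> R)
    (f : R -> R) (t : R) : R :=
  f t - \sum_(r < n) f (x r) * (tnth (n.-lagrange x) r).[t].

Lemma lagrange_remainder_node (R : realType) n (x : nat -> R) f (i : 'I_n) :
  injective (fun r : 'I_n => x r) -> lagrange_remainder n x f (x i) = 0.
Proof.
move=> injx; rewrite /lagrange_remainder (bigD1 i) //= horner_lagrange.
rewrite big1 => [|j ji]; last first.
  by rewrite divff// subr_eq0; apply: contraNneq ji => /injx ->.
rewrite big1 ?mulr1 ?addr0 ?subrr // => r ri.
by rewrite horner_lagrange (bigD1 i) 1?eq_sym //= subrr mul0r mul0r mulr0.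
Qed.

(* The classical bound is [M / n`! * (b - a) ^+ n]. *)
Lemma lagrange_remainder_bound (R : realType) (a b : R) n (x : nat -> R)
    (F : nat -> R -> R) (M t : R) :
  derivative_tower a b n F ->
  injective (fun r : 'I_n => x r) -> (forall r : 'I_n, x r \in `[a, b]) ->
  (forall z, z \in `[a, b] -> `|F n z| <= M) -> t \in `[a, b] ->
  `|lagrange_remainder n x (F 0%N) t| <= M * (b - a) ^+ n.
Proof.
move=> dF injx xab FM tab.
have M0 : 0 <= M by rewrite (le_trans (normr_ge0 _) (FM t tab)).
have ab0 : 0 <= b - a.
  by move: tab; rewrite in_itv /= subr_ge0 => /andP[/le_trans]; apply.
(* The nodal polynomial. If it vanishes at [t], then [t] is a node and the remainder is zero;
   otherwise one may divide by its value. *)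
pose w : {poly R} := \prod_(r < n) ('X - (x r)%:P).
have wE z : w.[z] = \prod_(r < n) (z - x r).
  by rewrite horner_prod; apply: eq_bigr => r _; rewrite hornerXsubC.
have [/eqP|wt] := eqVneq w.[t] 0.
  rewrite wE prodf_seq_eq0 => /hasP[/= r _]; rewrite subr_eq0 => /eqP ->.
  by rewrite lagrange_remainder_node // normr0 mulr_ge0 // exprn_ge0.
pose p : {poly R} := \sum_(r < n) (F 0%N (x r))%:P * tnth (n.-lagrange x) r.
have remE z : lagrange_remainder n x (F 0%N) z = F 0%N z - p.[z].
  congr (_ - _); rewrite horner_sum; apply: eq_bigr => r _.
  by rewrite hornerM hornerC.
(* [K] is chosen so that the error minus [K * w] vanishes at [t] as well as at the nodes. *)
have [K KE] : exists K, lagrange_remainder n x (F 0%N) t = K * w.[t].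
  by exists (lagrange_remainder n x (F 0%N) t / w.[t]); rewrite divfK.
have sizep : (size p <= n)%N.
  apply: (leq_trans (size_sum _ _ _)); apply/bigmax_leqP => r _.
  by rewrite mul_polyC (leq_trans (size_scale_leq _ _)) // size_npoly.
have wn : w^`(n) = n`!%:R%:P.
  have sizew : size w = n.+1 by rewrite /w -big_enum size_prod_XsubC size_enum_ord.
  have monw : w \is monic by apply: monic_prod => r _; exact: monicXsubC.
  apply/polyP => i; rewrite coef_derivn coefC.
  case: i => [|i] /=; last by rewrite nth_default ?mul0rn // sizew addnS ltnS leq_addr.
  rewrite addn0 ffactnn; move/monicP: monw; rewrite lead_coefE sizew => ->//.
(* The successive derivatives of [F 0 - p - K w], which has the [n + 1] zeros collected in [s]
   below. *)
pose G i := F i + (- 1 : R) *: horner (p + K *: w)^`(i).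
have dG : derivative_tower a b n G.
  by apply: derivative_towerD => //; apply: derivative_towerZ;
     exact: derivative_tower_horner.
have GE i z : G i z = F i z - (p + K *: w)^`(i).[z] by rewrite /G fctE scaleN1r.
pose s := t :: [seq x r | r : 'I_n].
have us : uniq s.
  rewrite /= map_inj_uniq ?enum_uniq // andbT; apply/mapP => -[r _ tr].
  move/negP: wt; apply; rewrite wE; apply/eqP.
  by rewrite (bigD1 r) //= tr subrr mul0r.
have [||z|c cab] := generalized_Rolle (s := sort <=%R s) dG.
- by rewrite size_sort /= size_map size_enum_ord.
- by rewrite sort_lt_sorted.
- rewrite mem_sort inE GE derivn0 hornerD hornerZ opprD addrA.
  case/predU1P => [->|/mapP[r _ ->]]; rewrite -remE.
    by rewrite KE subrr.
  rewrite lagrange_remainder_node // wE (bigD1 r) //= subrr mul0r mulr0 subrr.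
  by split.
(* The [n]-th derivative kills [p] and turns the monic [w] into [n!], so [F n c = K * n!]. Only
   [1 <= n!] is kept afterwards. *)
rewrite GE derivnD derivnZ wn (derivn_poly0 sizep) add0r hornerZ hornerC.
move=> /eqP; rewrite subr_eq0 => /eqP FnE.
have KM : `|K| <= M.
  apply: le_trans (FM c cab); rewrite FnE normrM ler_peMr // normr_nat.
  by rewrite ler1n fact_gt0.
rewrite KE normrM ler_pM // wE normr_prod -[n in _ ^+ n]card_ord -prodr_const.
apply: ler_prod => r _; rewrite normr_ge0 /=.
move: (xab r) tab; rewrite !in_itv /= => /andP[ar rb] /andP[at_ tb].
by rewrite ler_norml opprB; apply/andP; split; apply: lerB.
Qed.

(** * Slices of continuous functions and bounds on compact sets *)

Lemma continuous_slice_x (R : realType) (A B : set R) (f : R * R -> R) (y : R) :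
  B y -> {within A `*` B, continuous f} ->
  {within A, continuous (fun t => f (t, y))}.
Proof.
move=> By /subspace_continuousP cf; apply/subspace_continuousP => t At.
apply: cvg_comp (cf (t, y) (conj At By)) => P [[U V] /= [Ut Vy] UVP].
have By' := nbhs_singleton Vy.
by apply: filterS Ut => s Us As; apply: UVP.
Qed.

Lemma continuous_slice_y (R : realType) (A B : set R) (f : R * R -> R) (x : R) :
  A x -> {within A `*` B, continuous f} ->
  {within B, continuous (fun t => f (x, t))}.
Proof.
move=> Ax /subspace_continuousP cf; apply/subspace_continuousP => t Bt.
apply: cvg_comp (cf (x, t) (conj Ax Bt)) => P [[U V] /= [Ux Vt] UVP].
have Ux' := nbhs_singleton Ux.
by apply: filterS Vt => s Vs Bs; apply: UVP.
Qed.

Lemma continuous_compact_norm_bound (R : realType) (T : topologicalType)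
    (A : set T) (f : T -> R) :
  compact A -> {within A, continuous f} ->
  exists2 M : R, 0 < M & forall z, A z -> `|f z| <= M.
Proof.
move=> cptA cf; have [M [_ fM]] := compact_bounded (continuous_compact cf cptA).
(* Adding 1 makes the bound positive and strictly larger than [M], as the definition of boundedness
   requires. *)
exists (`|M| + 1) => [|z Az]; first by rewrite ltr_wpDl.
by apply: (fM (`|M| + 1)); [rewrite ltr_pwDr // ler_norm | exists z].
Qed.

(** * Nodes and mesh size *)

Lemma is_nodes_lt (R : realType) m (a b : R) x i j :
  is_nodes m a b x -> (i < j)%N -> (j <= m)%N -> x i < x j.
Proof.
move=> [_ _ xS]; elim: j => // j IHj; rewrite ltnS leq_eqVlt => /predU1P[-> /xS//|ij jm].
by rewrite (lt_trans _ (xS j jm)) // IHj // ltnW.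
Qed.

Lemma is_nodes_inj (R : realType) m (a b : R) x :
  is_nodes m a b x -> injective (fun r : 'I_m.+1 => x r).
Proof.
move=> xP i j xij; apply/val_inj/eqP; case: ltngtP => // ij.
- by have := is_nodes_lt xP ij (ltn_ord j); rewrite xij ltxx.
- by have := is_nodes_lt xP ij (ltn_ord i); rewrite xij ltxx.
Qed.

Lemma is_nodes_itv (R : realType) m (a b : R) x (r : 'I_m.+1) :
  is_nodes m a b x -> x r \in `[a, b].
Proof.
move=> xP; have [<- <- _] := xP; rewrite in_itv /=.
case: r => r /=; rewrite ltnS => rm; apply/andP; split.
- by case: r rm => // r rm; rewrite ltW // (is_nodes_lt xP).
- move: rm; rewrite leq_eqVlt => /predU1P[->//|rm].
  by rewrite ltW // (is_nodes_lt xP).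
Qed.

(** The length telescopes into [m] gaps, each at most the mesh size. *)
Lemma is_nodes_length_le_mesh (R : realType) m (a b : R) x :
  is_nodes m a b x -> b - a <= m%:R * mesh m x.
Proof.
move=> [<- <- _]; rewrite -(telescope_sumr x (leq0n m)) big_mkord.
rewrite mulr_natl -[m in _ *+ m]card_ord -sumr_const ler_sum // => r _.
rewrite (le_trans (ler_norm _)) // distrC.
exact: (le_bigmax _ (fun r : 'I_m => `|x r - x r.+1|)).
Qed.

(** Trades the interval length for mesh size, at the cost of a factor independent of the nodes. The
    bound [l] will be the common [h] of both directions. *)
Lemma is_nodes_length_exp_le (R : realType) m (a b l : R) x n :
  a <= b -> is_nodes m a b x -> mesh m x <= l ->
  (b - a) ^+ n <= m%:R ^+ n * l ^+ n.
Proof.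
move=> ab xP xl; rewrite -exprMn lerXn2r ?nnegrE ?subr_ge0 //.
  by rewrite mulr_ge0 // (le_trans _ xl) //; exact: bigmax_ge_id.
by rewrite (le_trans (is_nodes_length_le_mesh xP)) // ler_wpM2l.
Qed.

(** * The error on a rectangle *)

Lemma interpolant_errorE (R : realType) nx ny (x y : nat -> R)
    (u : R * R -> R) (z : R * R) :
  u z - interpolant nx ny x y u z =
    lagrange_remainder nx x (fun t => u (t, z.2)) z.1
    + lagrange_remainder ny y (fun t => u (z.1, t)) z.2
    - lagrange_remainder ny y
        (fun s => lagrange_remainder nx x (fun t => u (t, s)) z.1) z.2.
Proof.
case: z => s t; rewrite /lagrange_remainder /interpolant /=.
(* Expanding the inner remainder inside the outer sum produces the double sum of [interpolant], up
   to the order of summation. *)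
under [X in _ = _ - (_ - X)]eq_bigr do rewrite mulrBl mulr_suml.
rewrite sumrB exchange_big /=.
by ring.
Qed.

Section rectangle.
Variables (R : realType) (a b c d : R) (p q : nat) (u : R * R -> R).
Let Omega : set (R * R) := `[a, b] `*` `[c, d].
Hypothesis uC : Cpq p q Omega u.

(** Available for every [beta], since the x-derivatives are applied last in [partial_xy]. The
    section of the rectangle is all of [[a, b]], so the relative derivatives are ordinary inside. *)
Lemma partial_x_tower beta y : (beta <= q)%N -> y \in `[c, d] ->
  derivative_tower a b p (fun i t => partial_xy Omega i beta u (t, y)).
Proof.
move: uC => [_ dxu cu] lebq cdy; split=> [i leip|i t ltip abt].
  by apply: continuous_slice_x (cu _ _ leip lebq).
have abt' : t \in `[a, b] by apply: subset_itv_oo_cc.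
have := dxu i beta (t, y) ltip lebq (conj abt' cdy).
have sectE : ysection Omega y = `[a, b]%classic by rewrite in_ysectionX // inE.
rewrite /derivable_x /= sectE => /derivable_in_interior.
by rewrite interior_itv -[in derive_in _ _ _]sectE; apply.
Qed.

(** Restricted to x-order 0: the y-derivatives are applied first in [partial_xy], and interchanging
    derivatives is avoided. *)
Lemma partial_y_tower x : x \in `[a, b] ->
  derivative_tower c d q (fun i t => partial_xy Omega 0 i u (x, t)).
Proof.
move: uC => [dyu _ cu] abx; split=> [i leiq|i t ltiq cdt].
  by apply: continuous_slice_y (cu _ _ _ leiq).
have cdt' : t \in `[c, d] by apply: subset_itv_oo_cc.
have := dyu i (x, t) ltiq (conj abx cdt').
have sectE : xsection Omega x = `[c, d]%classic by rewrite in_xsectionX // inE.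
rewrite /derivable_y /= sectE => /derivable_in_interior.
by rewrite interior_itv -[in derive_in _ _ _]sectE; apply.
Qed.

(** As a function of [s], the x-remainder is a linear combination of the slices of [u] at [z.1] and
    at the nodes. Hence its [i]-th derivative is the x-remainder of the [i]-th y-derivative of [u],
    and the one-dimensional bound applies twice. *)
Lemma iterated_lagrange_remainder_bound (x y : nat -> R) (M : R) (z : R * R) :
  injective (fun r : 'I_p => x r) -> (forall r : 'I_p, x r \in `[a, b]) ->
  injective (fun r : 'I_q => y r) -> (forall r : 'I_q, y r \in `[c, d]) ->
  (forall w, Omega w -> `|partial_xy Omega p q u w| <= M) -> Omega z ->
  `|lagrange_remainder q y
      (fun s => lagrange_remainder p x (fun t => u (t, s)) z.1) z.2|
    <= M * (b - a) ^+ p * (d - c) ^+ q.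
Proof.
move=> injx xab injy ycd uM [abz cdz].
pose G i s :=
  lagrange_remainder p x (fun t => partial_xy Omega 0 i u (t, s)) z.1.
have dG : derivative_tower c d q G.
  (* The coefficients are extended by 0 to all natural numbers, the form that [derivative_tower_sum]
     takes. *)
  pose l r := if insub r is Some r' then (tnth (p.-lagrange x) r').[z.1] else 0.
  pose F r i s := partial_xy Omega 0 i u (x r, s).
  have -> : G = (fun i => (fun s => partial_xy Omega 0 i u (z.1, s)) +
      (-1) *: \sum_(r < p) l r *: F r i).
    apply/funext => i; apply/funext => s.
    rewrite !fctE scaleN1r fct_sumE; congr (_ - _); apply: eq_bigr => r _.
    by rewrite /l valK fctE mulrC.
  apply: derivative_towerD; first exact: partial_y_tower.
  apply/derivative_towerZ/derivative_tower_sum => r rp.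
  exact: partial_y_tower (xab (Ordinal rp)).
(* The outer bound, in y, is used with [M * (b - a) ^+ p] in place of [M]; the inner one, in x,
   supplies that value. *)
apply: (lagrange_remainder_bound dG) => // s cds.
apply: (lagrange_remainder_bound (partial_x_tower (leqnn q) cds)) => // t abt.
exact: uM.
Qed.

End rectangle.

(** * The error in terms of the mesh size *)

Lemma interpolant_error_bound (R : realType) (mx my : nat) (a b c d : R)
    (u : R * R -> R) :
  (0 < mx)%N -> (0 < my)%N -> a < b -> c < d ->
  let Omega : set (R * R) := `[a, b] `*` `[c, d] in
  Cpq mx.+1 my.+1 Omega u ->
  exists2 C : R, 0 < C &
     forall x y : nat -> R, is_nodes mx a b x -> is_nodes my c d y ->
     let h := Num.max (mesh mx x) (mesh my y) in
     (supnorm Omega (u - interpolant mx.+1 my.+1 x y u)%R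
       <= (C * (h ^+ mx.+1 + h ^+ my.+1 + h ^+ (mx + my + 2)))%:E)%E.
Proof.
move=> mx0 my0 ab cd Omega uC.
have cptO : compact Omega by apply: compact_setX; exact: segment_compact.
have bound p q : (p <= mx.+1)%N -> (q <= my.+1)%N -> exists2 M : R, 0 < M &
    forall z, Omega z -> `|partial_xy Omega p q u z| <= M.
  case: uC => _ _ cu lep leq.
  exact: continuous_compact_norm_bound cptO (cu _ _ lep leq).
have [Mx Mx0 uMx] := bound mx.+1 0%N (leqnn _) (leq0n _).
have [My My0 uMy] := bound 0%N my.+1 (leq0n _) (leqnn _).
have [Mxy Mxy0 uMxy] := bound mx.+1 my.+1 (leqnn _) (leqnn _).
pose kx : R := mx%:R ^+ mx.+1; pose ky : R := my%:R ^+ my.+1.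
have kx0 : 0 < kx by rewrite exprn_gt0 // ltr0n.
have ky0 : 0 < ky by rewrite exprn_gt0 // ltr0n.
(* One summand for each term of the error decomposition. It is fixed before the nodes, so it does
   not depend on them. *)
exists (Mx * kx + My * ky + Mxy * kx * ky).
  by rewrite !addr_gt0 // !mulr_gt0.
move=> x y xP yP; set h := Num.max _ _; cbv zeta.
have hx : (b - a) ^+ mx.+1 <= kx * h ^+ mx.+1.
  by apply: is_nodes_length_exp_le (ltW ab) xP _; rewrite le_max lexx.
have hy : (d - c) ^+ my.+1 <= ky * h ^+ my.+1.
  by apply: is_nodes_length_exp_le (ltW cd) yP _; rewrite le_max lexx orbT.
have h0 : 0 <= h by rewrite le_max bigmax_ge_id.
apply: ub_ereal_sup => _ [z Oz <-]; rewrite lee_fin.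
rewrite -[(u - _) z]/(u z - interpolant mx.+1 my.+1 x y u z) interpolant_errorE.
have [abz cdz] := Oz.
have injx := is_nodes_inj xP; have injy := is_nodes_inj yP.
have xab r := is_nodes_itv r xP; have ycd r := is_nodes_itv r yP.
have dcq0 : 0 <= (d - c) ^+ my.+1 by rewrite exprn_ge0 // subr_ge0 ltW.
have bap0 : 0 <= (b - a) ^+ mx.+1 by rewrite exprn_ge0 // subr_ge0 ltW.
apply: (@le_trans _ _ (Mx * (b - a) ^+ mx.+1 + My * (d - c) ^+ my.+1 +
    Mxy * (b - a) ^+ mx.+1 * (d - c) ^+ my.+1)).
  rewrite (le_trans (ler_normB _ _)) // lerD //; last first.
    exact: iterated_lagrange_remainder_bound.
  rewrite (le_trans (ler_normD _ _)) // lerD //.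
    apply: (lagrange_remainder_bound (partial_x_tower uC (leq0n _) cdz)) => //.
    by move=> t abt; apply: uMx.
  apply: (lagrange_remainder_bound (partial_y_tower uC abz)) => // t cdt.
  exact: uMy.
have -> : h ^+ (mx + my + 2) = h ^+ mx.+1 * h ^+ my.+1.
  by rewrite -exprD addn2 addSn addnS.
set X := h ^+ mx.+1 in hx *; set Y := h ^+ my.+1 in hy *.
have X0 : 0 <= X by exact: exprn_ge0.
have Y0 : 0 <= Y by exact: exprn_ge0.
apply: (@le_trans _ _ (Mx * kx * X + My * ky * Y + Mxy * kx * ky * (X * Y))).
  have -> : Mxy * kx * ky * (X * Y) = Mxy * (kx * X * (ky * Y)) by ring.
  by rewrite -3!mulrA !lerD // ler_pM2l // ler_pM.
have A0 : 0 <= Mx * kx by rewrite mulr_ge0 // ltW.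
have B0 : 0 <= My * ky by rewrite mulr_ge0 // ltW.
have D0 : 0 <= Mxy * kx * ky by rewrite !mulr_ge0 // ltW.
have XY0 : 0 <= X * Y by rewrite mulr_ge0.
(* Each of the three nonnegative coefficients is at most their sum, and the powers they multiply are
   nonnegative. *)
by nra.
Qed.

Theorem proposition1 (R : realType) (mx my : nat) (a b c d : R)
    (u : R * R -> R) :
  (1 <= mx)%N -> (1 <= my)%N -> a < b -> c < d ->
  let Omega : set (R * R) := `[a, b] `*` `[c, d] in
  Cpq mx.+1 my.+1 Omega u ->
  (exists2 C : R, 0 < C &
     forall x y : nat -> R, is_nodes mx a b x -> is_nodes my c d y ->
     let h := Num.max (mesh mx x) (mesh my y) in
     (supnorm Omega (u - interpolant mx.+1 my.+1 x y u)%R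
       <= (C * (h ^+ mx.+1 + h ^+ my.+1 + h ^+ (mx + my + 2)))%:E)%E)
  /\
  (forall m : nat, m = mx -> m = my ->
   exists C : R,
     forall x y : nat -> R, is_nodes mx a b x -> is_nodes my c d y ->
     let h := Num.max (mesh mx x) (mesh my y) in
     h < 1 ->
     (supnorm Omega (u - interpolant mx.+1 my.+1 x y u)%R
       <= (C * h ^+ m.+1)%:E)%E).
Proof.
move=> mx0 my0 ab cd Omega uC.
have [C C0 main] := interpolant_error_bound mx0 my0 ab cd uC.
split; first by exists C.
(* The factor 3 counts the powers of [h]: two equal [h ^+ m.+1], and the third, of exponent
   [2m + 2], is no larger because [h < 1]. *)
move=> m mE mE'; exists (C * 3) => x y xP yP; set h := Num.max _ _; cbv zeta.
move=> h1; have := main x y xP yP; rewrite -/h; cbv zeta => /le_trans; apply.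
have h0 : 0 <= h by rewrite le_max bigmax_ge_id.
rewrite -mE -mE' lee_fin -mulrA ler_wpM2l ?(ltW C0) //.
have : h ^+ (m + m + 2) <= h ^+ m.+1.
  by rewrite ler_wiXn2l ?(ltW h1) // addn2 !ltnS leqW ?leq_addr.
by lra.
Qed.
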